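(* Let $k$ be a field, $R=k[X_0,\ldots,X_{m-1}]$, and let $\mathcal{F},\mathcal{G}\subset R$ be finite subsets which generate ideals $I$ respectively $J$. Let $A\in\mathrm{Aff}_m(k)$ and let $k'/k$ be a field extension. The following hold. \begin{enumerate} \item One has $d_{\mathcal{F}}\in\mathbf{Z}_{\ge0}$ (that is, $d_{\mathcal{F}}$ is finite). \item Let $\mathcal{B}$ be a Gröbner basis of $I$ with respect to some degree refining monomial order on $R$. Then there is an integer $c\in\mathbf{Z}_{\ge0}$ such that $\mathcal{B}\subseteq V_{\mathcal{F},c}$ and one has $d_{\mathcal{F}}\le c$. \item $d_{\mathcal{F}}$ is the largest $c\in\mathbf{Z}_{\ge0}$ such that $V_{\mathcal{F},c}\cap R_{\le c-1}\ne V_{\mathcal{F},c-1}$. \item If $\mathrm{Span}_k(\mathcal{F})=\mathrm{Span}_k(\mathcal{G})$, then $\max(d_{\mathcal{F}},\deg(\mathcal{F}))=\max(d_{\mathcal{G}},\deg(\mathcal{F}))$. \item One has $d_{\mathcal{F}}=d_{A\mathcal{F}}$. \item Consider the set $\{f\otimes1:f\in\mathcal{F}\}\subset k'[X_0,\ldots,X_{m-1}]$. One has $d_{\{f\otimes1:\,f\in\mathcal{F}\}}=d_{\mathcal{F}}$. \item If $I=J$ and $\mathcal{F}\subseteq\mathcal{G}$, then $d_{\mathcal{G}}\le d_{\mathcal{F}}$. \item If $g\in V_{\mathcal{F},j}$, then $d_{\mathcal{F}}\le\max(j,d_{\mathcal{F}\cup\{g\}})$. \end{enumerate}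
   Context: Degree means total degree; $R_{\le i}$ is the set of polynomials in $R$ of degree at most $i$ (so $R_{\le-1}=\{0\}$), and $\deg(\mathcal{F})=\max\{\deg(f):f\in\mathcal{F}\}$. The affine group $\mathrm{Aff}_m(k)=k^m\rtimes\mathrm{GL}_m(k)$ acts on $R$ by affine change of variables, and $A\mathcal{F}=\{Af:f\in\mathcal{F}\}$. A degree refining monomial order is one that compares monomials first by total degree. For $i\in\mathbf{Z}_{\ge0}$, $V_{\mathcal{F},i}$ is the smallest $k$-vector space such that (1) $\{f\in\mathcal{F}:\deg(f)\le i\}\subseteq V_{\mathcal{F},i}$; (2) if $g\in V_{\mathcal{F},i}$ and $h\in R$ with $\deg(hg)\le i$, then $hg\in V_{\mathcal{F},i}$. Set $V_{\mathcal{F},\infty}=I$, and by convention $V_{\mathcal{F},-1}=\emptyset$. The last fall degree $d_{\mathcal{F}}$ is the minimal $d\in\mathbf{Z}_{\ge0}\sqcup\{\infty\}$ such that for all $f\in I$ one has $f\in V_{\mathcal{F},\max(d,\deg(f))}$. The same definitions apply over any field; in item (6) the set $\{f\otimes1\}$ is considered over the field $k'$ in $k'[X_0,\ldots,X_{m-1}]=R\otimes_kk'$. *)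

(* Defs.v *)
From HB Require Import structures.
From mathcomp Require Import all_boot all_order all_algebra.
From mathcomp Require Import finmap.
From mathcomp Require Import mpoly.
From Stdlib Require Import Classical ClassicalEpsilon.

Set Implicit Arguments.
Unset Strict Implicit.
Unset Printing Implicit Defensive.

Import Order.TTheory GRing.Theory Num.Theory.
Local Open Scope fset_scope.
Local Open Scope ring_scope.

(* The ordered set of natural numbers extended by a top element. *)
Inductive enat := Fin of nat | Infty.

Definition ele (a b : enat) : Prop :=
  match a, b with
  | _, Infty => True
  | Infty, Fin _ => False
  | Fin x, Fin y => (x <= y)%N
  end.

Definition emax (a b : enat) : enat :=
  match a, b with
  | Fin x, Fin y => Fin (maxn x y)
  | _, _ => Infty
  end.

Section Polynomials.
Variables (k : fieldType) (m : nat).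
Local Notation R := {mpoly k[m]}.

(* Total degree, with the zero polynomial sent to 0. Below, degrees are only
   compared with naturals, or occur in a maximum with an element of [enat], so
   any value <= 0 for the degree of 0 yields the same notions; [degree_le]
   treats 0 apart because there the bound may be negative. *)
Definition deg (f : R) : nat := (msize f).-1.

Definition degree_le (i : int) (f : R) : Prop := f = 0 \/ (deg f)%:Z <= i.

Definition deg_set (F : {fset R}) : nat := (\max_(f <- F) deg f)%N.

Definition subspace (W : R -> Prop) : Prop :=
  W 0 /\ forall (a : k) f g, W f -> W g -> W (a *: f + g).

Definition lin_span (S : R -> Prop) (f : R) : Prop :=
  forall W, subspace W -> (forall g, S g -> W g) -> W f.

Definition is_ideal (J : R -> Prop) : Prop :=
  [/\ J 0, forall f g, J f -> J g -> J (f + g)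
     & forall h g, J g -> J (h * g)].

Definition ideal_gen (S : R -> Prop) (f : R) : Prop :=
  forall J, is_ideal J -> (forall g, S g -> J g) -> J f.

Definition ideal (F : {fset R}) : R -> Prop := ideal_gen (fun f => f \in F).

Definition V (F : {fset R}) (i : nat) (f : R) : Prop :=
  forall W : R -> Prop, subspace W ->
    (forall g, g \in F -> (deg g <= i)%N -> W g) ->
    (forall g h, W g -> (deg (h * g) <= i)%N -> W (h * g)) ->
  W f.

(* The families V_{F,i} for i >= 0 or infinite, and for i >= -1. *)
Definition Vext (F : {fset R}) (i : enat) : R -> Prop :=
  match i with Fin n => V F n | Infty => ideal F end.

Definition Vint (F : {fset R}) (i : int) : R -> Prop :=
  match i with Posz n => V F n | Negz _ => fun=> False end.

Definition fall_bound (F : {fset R}) (d : enat) : Prop :=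
  forall f, ideal F f -> Vext F (emax d (Fin (deg f))) f.

Definition is_last_fall_degree (F : {fset R}) (d : enat) : Prop :=
  fall_bound F d /\ forall e, fall_bound F e -> ele d e.

Definition last_fall_degree (F : {fset R}) : enat :=
  epsilon (inhabits Infty) (is_last_fall_degree F).

Lemma last_fall_degreeP (F : {fset R}) :
  is_last_fall_degree F (last_fall_degree F).
Proof.
apply: epsilon_spec.
have [[n bn]|nob] := classic (exists n, fall_bound F (Fin n)); last first.
  by exists Infty; split=> // -[n|//] bn; case: nob; exists n.
have: exists2 n, fall_bound F (Fin n)
    & forall p, (p < n)%N -> ~ fall_bound F (Fin p).
  elim/ltn_ind: n bn => n IH bn.
  have [[p ltpn bp]|noless] :=
    classic (exists2 p, (p < n)%N & fall_bound F (Fin p)); first exact: IH bp.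
  by exists n => // p ltpn bp; apply: noless; exists p.
case=> p bp minp; exists (Fin p); split=> // -[q|//] bq /=.
by rewrite leqNgt; apply/negP=> /minp.
Qed.

Definition monomial_order (le : rel 'X_{1..m}) : Prop :=
  [/\ reflexive le /\ transitive le, antisymmetric le /\ total le,
      forall a b c, le a b -> le (a + c)%MM (b + c)%MM
    & forall a, le 0%MM a].

Definition degree_refining (le : rel 'X_{1..m}) : Prop :=
  forall a b : 'X_{1..m}, (mdeg a < mdeg b)%N -> le a b.

Definition leading_monomial (le : rel 'X_{1..m}) (f : R) (a : 'X_{1..m}) :=
  a \in msupp f /\ forall b, b \in msupp f -> le b a.

Definition leading_terms (le : rel 'X_{1..m}) (S : R -> Prop) (t : R) : Prop :=
  exists f a, [/\ S f, leading_monomial le f a & t = f@_a *: 'X_[a]].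

Definition groebner_basis (le : rel 'X_{1..m}) (I : R -> Prop)
    (B : {fset R}) : Prop :=
  (forall b, b \in B -> I b) /\
  forall f, ideal_gen (leading_terms le (fun b => b \in B)) f
        <-> ideal_gen (leading_terms le I) f.

(* Elements of k^m x| GL_m(k), seen as the maps x |-> x *m M + b on row
   vectors. Acting on points from the right makes the action
   (A f)(x) = f (x *m M + b) on polynomials a left action. *)
Record affine := Affine {
  aff_vec : 'rV[k]_m;
  aff_mx : 'M[k]_m;
  aff_unit : aff_mx \in unitmx }.

Definition aff_act (A : affine) (f : R) : R :=
  comp_mpoly
    [tuple \sum_(i < m) aff_mx A i j *: 'X_i + (aff_vec A 0 j)%:MP | j < m] f.

End Polynomials.

(* Main.v *)
(* Finiteness comes from Groebner bases for a degree refining order: if a basis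
   B lies in V_c, dividing f in I by B writes f as a sum of products h b of degree
   at most deg f, so f lies in V_max(c, deg f); a suitable finite B exists by
   Dickson's lemma.  The characterisation by degree falls and the comparisons
   between F and G only use that V_i is monotone in i and in its generators.
   Affine changes of variables preserve degrees in both directions and therefore
   carry V_F,i onto V_AF,i.  For a field extension k'/k the point is that
   V_F,i (x) k' is closed under the products allowed in degree i: writing an
   element as sum_j c_j g_j with the c_j linearly independent over k, no
   cancellation of top degrees can occur, so each g_j has degree at most that of
   the sum. *)
Require Import Defs.
From HB Require Import structures.
From mathcomp Require Import all_boot all_order all_algebra.
From mathcomp Require Import finmap.
From mathcomp Require Import mpoly.
From Stdlib Require Import Classical.

Set Implicit Arguments.
Unset Strict Implicit.
Unset Printing Implicit Defensive.

Import Order.TTheory GRing.Theory Num.Theory.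
Local Open Scope fset_scope.
Local Open Scope ring_scope.

(** * Degrees, the spaces [V F i], and their union *)

Section FallDegree.
Variables (k : fieldType) (m : nat).
Local Notation R := {mpoly k[m]}.
Implicit Types (F G : {fset R}) (f g h p q : R) (W : R -> Prop).

Lemma deg_leP f i :
  reflect (forall a, a \in msupp f -> (mdeg a <= i)%N) (deg f <= i)%N.
Proof.
apply: (iffP idP) => [le_fi a /msize_mdeg_lt|le_i].
  by rewrite /deg in le_fi; case: (msize f) le_fi => //= n le_ni lt_an;
    apply: leq_trans le_ni.
have [->|nz_f] := eqVneq f 0; first by rewrite /deg msize0.
by rewrite /deg -(mlead_deg nz_f) le_i ?mlead_supp.
Qed.

Lemma mdeg_le_deg f a : a \in msupp f -> (mdeg a <= deg f)%N.
Proof. by move: a; apply/deg_leP. Qed.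

Lemma deg0 : deg (0 : R) = 0%N.
Proof. by rewrite /deg msize0. Qed.

Lemma degX a : deg ('X_[a] : R) = mdeg a.
Proof. by rewrite /deg msizeX. Qed.

Lemma degM f g : f != 0 -> g != 0 -> deg (f * g) = (deg f + deg g)%N.
Proof.
move=> nz_f nz_g; rewrite /deg msizeM //.
by rewrite (mpolySpred _ nz_f) (mpolySpred _ nz_g) /= addnS.
Qed.

Lemma degM_le f g : (deg (f * g) <= deg f + deg g)%N.
Proof.
have [->|nz_f] := eqVneq f 0; first by rewrite mul0r deg0.
have [->|nz_g] := eqVneq g 0; first by rewrite mulr0 deg0.
by rewrite degM.
Qed.

(** Packaged as a [subspace] so that it can serve as the test space [W] in the definition of [V]. *)
Lemma deg_subspace i : @subspace k m (fun f => (deg f <= i)%N).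
Proof.
split=> [|a f g /deg_leP le_f /deg_leP le_g]; first by rewrite deg0.
apply/deg_leP => b /msuppD_le; rewrite mem_cat => /orP[/msuppZ_le|];
  by [apply: le_f | apply: le_g].
Qed.

Lemma subspaceZ W a f : subspace W -> W f -> W (a *: f).
Proof. by case=> W0 WD Wf; rewrite -[a *: f]addr0; apply: WD. Qed.

Lemma subspaceD W f g : subspace W -> W f -> W g -> W (f + g).
Proof. by case=> W0 WD Wf Wg; rewrite -[f]scale1r; apply: WD. Qed.

Lemma subspace_sum W (sW : subspace W) (I : Type) (r : seq I) (P : pred I)
    (E : I -> R) :
  (forall i, P i -> W (E i)) -> W (\sum_(i <- r | P i) E i).
Proof.
move=> WE; elim/big_ind: _ => // [|x y]; first by case: sW.
exact: subspaceD.
Qed.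

Lemma V_subspace F i : subspace (V F i).
Proof.
split=> [W [W0 _] //|a f g Vf Vg W sW genW mulW].
by case: (sW) => _; apply; [apply: Vf | apply: Vg].
Qed.

Lemma V0 F i : V F i 0.
Proof. by case: (V_subspace F i). Qed.

Lemma V_gen F i g : g \in F -> (deg g <= i)%N -> V F i g.
Proof. by move=> Fg le_gi W _ genW _; apply: genW. Qed.

Lemma V_mul F i g h : V F i g -> (deg (h * g) <= i)%N -> V F i (h * g).
Proof. by move=> Vg le_i W sW genW mulW; apply: (mulW) => //; apply: Vg. Qed.

Lemma V_deg F i f : V F i f -> (deg f <= i)%N.
Proof. by move/(_ _ (deg_subspace i)); apply. Qed.

Lemma ideal_is_ideal F : is_ideal (ideal F).
Proof.
split=> [J [] //|f g If Ig J iJ sJ|h g Ig J iJ sJ].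
  by case: (iJ) => _ JD _; apply: JD; [apply: If | apply: Ig].
by case: (iJ) => _ _; apply; apply: Ig.
Qed.

Lemma ideal_subspace F : subspace (ideal F).
Proof.
have [I0 ID IM] := ideal_is_ideal F; split=> // a f g If Ig.
by apply: ID => //; rewrite -mul_mpolyC; apply: IM.
Qed.

Lemma ideal_sub F G :
  (forall g, g \in F -> ideal G g) -> forall f, ideal F f -> ideal G f.
Proof. by move=> sFG f; apply=> //; apply: ideal_is_ideal. Qed.

Lemma ideal_in F g : g \in F -> ideal F g.
Proof. by move=> Fg J _; apply. Qed.

Lemma V_ideal F i f : V F i f -> ideal F f.
Proof.
apply=> [|g Fg _|g h Ig _]; first exact: ideal_subspace.
  exact: ideal_in.
by case: (ideal_is_ideal F) => _ _; apply.
Qed.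

(** [V G j] is itself a test space for [V F i], since a product allowed in degree [i] is allowed in
    degree [j]. Comparisons of two generating sets reduce to this check on generators. *)
Lemma V_sub F G i j : (i <= j)%N ->
  (forall g, g \in F -> (deg g <= i)%N -> V G j g) ->
  forall f, V F i f -> V G j f.
Proof.
move=> le_ij sFG f; apply=> //; first exact: V_subspace.
by move=> g h Vg le_i; apply: V_mul => //; apply: leq_trans le_ij.
Qed.

Lemma V_leq F i j f : (i <= j)%N -> V F i f -> V F j f.
Proof.
move=> le_ij; apply: V_sub => // g Fg le_gi.
by apply: V_gen => //; apply: leq_trans le_ij.
Qed.

(** The union of the [V F i] is an ideal: a product [h * g] becomes admissible once the index
    reaches its degree. *)
Lemma ideal_V F f : ideal F f -> exists i, V F i f.
Proof.
move/(_ (fun f => exists i, V F i f)); apply=> [|g Fg]; last first.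
  by exists (deg g); apply: V_gen.
split=> [|f1 f2 [i Vf1] [j Vf2]|h g [i Vg]].
- by exists 0%N; apply: V0.
- exists (maxn i j); apply: (subspaceD (V_subspace F _)).
    by apply: V_leq Vf1; rewrite leq_maxl.
  by apply: V_leq Vf2; rewrite leq_maxr.
exists (maxn i (deg (h * g))); apply: V_mul; last by rewrite leq_maxr.
by apply: V_leq Vg; rewrite leq_maxl.
Qed.

Lemma seq_ideal_V F (s : seq R) : (forall b, b \in s -> ideal F b) ->
  exists c, forall b, b \in s -> V F c b.
Proof.
elim: s => [|b s IH] Is; first by exists 0%N.
have [|c Vc] := IH; first by move=> x sx; apply: Is; rewrite inE sx orbT.
have [|i Vb] := @ideal_V F b; first by apply: Is; rewrite mem_head.
exists (maxn c i) => x; rewrite inE => /predU1P[->|/Vc Vx].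
  by apply: V_leq Vb; rewrite leq_maxr.
by apply: V_leq Vx; rewrite leq_maxl.
Qed.

Lemma ele_anti (a b : enat) : ele a b -> ele b a -> a = b.
Proof.
case: a b => [x|] [y|] //= le_xy le_yx.
by congr Fin; apply/eqP; rewrite eqn_leq le_xy.
Qed.

Lemma last_fall_degree_bound F : fall_bound F (last_fall_degree F).
Proof. by case: (last_fall_degreeP F). Qed.

Lemma last_fall_degree_min F e : fall_bound F e -> ele (last_fall_degree F) e.
Proof. by case: (last_fall_degreeP F) => _; apply. Qed.

Lemma fall_bound_Infty F : fall_bound F Infty.
Proof. by []. Qed.

Lemma fall_bound_le F d e : ele d e -> fall_bound F d -> fall_bound F e.
Proof.
case: e => [e|] le_de bd; last exact: fall_bound_Infty.
case: d le_de bd => [d|] //= le_de bd f /bd.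
by apply: V_leq; rewrite geq_max leq_maxr leq_max le_de.
Qed.

(** * Division along a degree refining monomial order *)

Section Division.
Variable le : rel 'X_{1..m}.
Hypotheses (le_mo : monomial_order le) (le_deg : degree_refining le).

Lemma ex_leading_monomial f : f != 0 -> exists a, leading_monomial le f a.
Proof.
have [[le_refl le_tr] [_ le_tot] _ _] := le_mo.
rewrite -msupp_eq0 /leading_monomial; elim: (msupp f) => // a [|b s] IH _.
  by exists a; split=> [|b]; rewrite ?mem_head // inE => /eqP->.
have [//|c [sc cmax]] := IH.
have [le_ac|le_ca] := orP (le_tot a c).
  exists c; split=> [|d]; first by rewrite inE sc orbT.
  by rewrite inE => /predU1P[->|/cmax].
exists a; split=> [|d]; first by rewrite mem_head.
by rewrite inE => /predU1P[->|/cmax le_dc] //; apply: le_tr le_ca.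
Qed.

(** A monomial of [f] of larger degree would lie above [a] by refinement and below it by maximality,
    hence equal it. *)
Lemma mdeg_leading f a : leading_monomial le f a -> mdeg a = deg f.
Proof.
have [_ [le_anti _] _ _] := le_mo => -[fa amax].
apply/eqP; rewrite eqn_leq mdeg_le_deg //=; apply/deg_leP => b fb.
rewrite leqNgt; apply/negP => lt_ab.
have ab : a = b by apply: le_anti; rewrite amax // andbT le_deg.
by rewrite ab ltnn in lt_ab.
Qed.

Lemma le_mdeg a b : le a b -> (mdeg a <= mdeg b)%N.
Proof.
have [_ [le_anti _] _ _] := le_mo => le_ab; rewrite leqNgt; apply/negP => lt_ba.
have ab : a = b by apply: le_anti; rewrite le_ab le_deg.
by rewrite ab ltnn in lt_ba.
Qed.

(* Only finitely many monomials lie below a given one, as their degrees are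
   bounded. *)
Lemma monomial_order_ind (P : 'X_{1..m} -> Prop) :
  (forall a, (forall b, le b a -> b != a -> P b) -> P a) -> forall a, P a.
Proof.
have [[le_refl le_tr] [le_anti _] _ _] := le_mo => step a.
(* Induction on the number of monomials below [x]; the degree bound [n] stays fixed so that they
   live in one finite type. *)
suff wf n x : (mdeg x <= n)%N -> forall c,
    (#|[set b : 'X_{1..m < n.+1} | le (bmnm b) x]| <= c)%N -> P x.
  exact: (wf (mdeg a) a).
move=> le_xn c; elim: c x le_xn => [|c IH] x le_xn.
  rewrite leqn0 cards_eq0 => /eqP/setP/(_ (BMultinom (bound := n.+1) le_xn)).
  by rewrite !inE /= le_refl.
move=> cardx; apply: step => y le_yx neq_yx.
have le_yn : (mdeg y <= n)%N by apply: leq_trans le_xn; apply: le_mdeg.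
apply: IH => //; rewrite -ltnS; apply: leq_trans cardx; apply: proper_card.
apply/properP; split.
  by apply/subsetP => b; rewrite !inE => /le_tr; apply.
exists (BMultinom (bound := n.+1) le_xn); rewrite !inE //=.
by apply: contra neq_yx => le_xy; apply/eqP/le_anti; rewrite le_yx.
Qed.

Lemma leading_mulX f a d :
  leading_monomial le f a -> leading_monomial le (f * 'X_[d]) (d + a).
Proof.
have [_ _ le_add _] := le_mo => -[fa amax].
split=> [|b]; first by rewrite mcoeff_msupp mcoeffMX -mcoeff_msupp.
rewrite (perm_mem (msuppMX _ _)) => /mapP[c fc ->].
by rewrite ![(d + _)%MM]addmC; apply/le_add/amax.
Qed.

(** Cancels leading terms by well-founded induction on the leading monomial. [B] is a predicate, to
    cover both a given Gröbner basis and the sequence found by Dickson's lemma. *)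
Lemma division_fall_bound F (B : R -> Prop) c :
  (forall b, B b -> V F c b) ->
  (forall f a, ideal F f -> leading_monomial le f a ->
     exists b e, [/\ B b, leading_monomial le b e & (e <= a)%MM]) ->
  fall_bound F (Fin c).
Proof.
move=> BV divB f If; change (V F (maxn c (deg f)) f).
have [->|nz_f] := eqVneq f 0; first exact: V0.
have [a lead_fa] := ex_leading_monomial nz_f.
move: a f If nz_f lead_fa; apply: monomial_order_ind => a IH f If nz_f lead_fa.
have [b [e [Bb lead_be le_ea]]] := divB f a If lead_fa.
have lead_q := leading_mulX (a - e)%MM lead_be; rewrite submK // in lead_q.
set q := b * _ in lead_q; set n := maxn c _.
have deg_q : deg q = deg f.
  by rewrite -(mdeg_leading lead_q) -(mdeg_leading lead_fa).
(* [q] has the leading monomial of [f], hence its degree, so forming it is an allowed product in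
   degree [n]. *)
have Vq : V F n q.
  rewrite /q mulrC; apply: V_mul; last by rewrite mulrC -/q deg_q leq_maxr.
  by apply: V_leq (BV b Bb); rewrite leq_maxl.
pose z := f@_a / q@_a; pose f' := f - z *: q.
have f'a : f'@_a = 0.
  rewrite mcoeffB mcoeffZ divfK ?subrr // -mcoeff_msupp.
  by case: lead_q.
have deg_f' : (deg f' <= deg f)%N.
  rewrite /f' addrC -scaleNr; case: (deg_subspace (deg f)) => _; apply=> //.
  by rewrite deg_q.
have If' : ideal F f'.
  rewrite /f' addrC -scaleNr; case: (ideal_subspace F) => _; apply=> //.
  exact: V_ideal Vq.
rewrite -[f](subrK (z *: q)) -/f'.
apply: (subspaceD (V_subspace F n)); last exact: subspaceZ (V_subspace F n) Vq.
have [->|nz_f'] := eqVneq f' 0; first exact: V0.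
have [a' lead_f'] := ex_leading_monomial nz_f'.
(* The induction hypothesis speaks of the degree of [f'], which may be smaller than that of [f]. *)
apply: (@V_leq _ (maxn c (deg f'))).
  by rewrite geq_max leq_maxl leq_max deg_f' orbT.
apply: (IH a') => //.
  case: lead_f' => /msuppB_le; rewrite mem_cat => /orP[|/msuppZ_le] ? _.
    by case: lead_fa => _; apply.
  by case: lead_q => _; apply.
apply/eqP => aa'; case: lead_f' => + _.
by rewrite aa' mcoeff_msupp f'a eqxx.
Qed.

Lemma groebner_fall_bound F (B : {fset R}) c :
  groebner_basis le (ideal F) B -> (forall b, b \in B -> V F c b) ->
  fall_bound F (Fin c).
Proof.
case=> BI ltB BV; apply: division_fall_bound BV _ => f a If lead_fa.
(* [J] is the monomial ideal of the leading monomials of [B], described through supports. It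
   contains the leading term of [f], which yields the required divisor. *)
pose J f := forall a, a \in msupp f ->
  exists b e, [/\ b \in B, leading_monomial le b e & (e <= a)%MM].
have iJ : is_ideal J.
  split=> [x|f1 f2 J1 J2 x|h g Jg x]; first by rewrite msupp0.
    by move/msuppD_le; rewrite mem_cat => /orP[/J1|/J2].
  move=> /msuppM_le/allpairsP[[u v] /= [_ /Jg[b [e [Bb be le_ev]]] ->]].
  by exists b, e; split=> //; apply: lepm_trans le_ev _; apply: lem_addl.
have nz_fa : f@_a != 0 by rewrite -mcoeff_msupp; case: lead_fa.
have : ideal_gen (leading_terms le (ideal F)) (f@_a *: 'X_[a]).
  by move=> K _; apply; exists f, a.
move/ltB/(_ J iJ); apply; last by rewrite msuppMCX // mem_head.
move=> _ [b [e [Bb be ->]]] x /msuppZ_le; rewrite msuppX inE => /eqP->.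
by exists b, e; split=> //; apply: lepm_refl.
Qed.
End Division.

(** * Dickson's lemma and finiteness of the last fall degree *)

Lemma dickson (T : eqType) (P : T -> Prop) (w : T -> 'X_{1..m}) :
  exists s : seq T, (forall x, x \in s -> P x) /\
    forall x, P x -> exists2 y, y \in s & (w y <= w x)%MM.
Proof.
(* Induction on the number [r] of coordinates compared, for all [P] at once, because the step
   applies it to slices of [P]. *)
suff gen r : (r <= m)%N -> forall P : T -> Prop,
    exists s : seq T, (forall x, x \in s -> P x) /\
      forall x, P x -> exists2 y, y \in s &
        forall i : 'I_m, (i < r)%N -> (w y i <= w x i)%N.
  have [s [sP sdom]] := gen m (leqnn m) P; exists s; split=> // x.
  case/sdom=> y sy le_yx; exists y => //.
  by apply/mnm_lepP => i; apply: le_yx.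
elim: r => [|r IH] lt_rm {}P.
  have [[x Px]|noP] := classic (exists x, P x).
    exists [:: x]; split=> [y|y _]; first by rewrite inE => /eqP->.
    by exists x; rewrite ?mem_head.
  by exists [::]; split=> // x Px; case: noP; exists x.
pose j := Ordinal lt_rm.
have [s [sP sdom]] := IH (ltnW lt_rm) P.
(* If coordinate [j] of [x] reaches the maximum over [s], then [s] also dominates there. The smaller
   values form finitely many slices of constant coordinate [j], which [t] collects one by one. *)
have [t [tP tdom]] : exists t : seq T, (forall x, x \in t -> P x) /\
    forall x, P x -> (w x j < \max_(y <- s) w y j)%N ->
    exists2 y, y \in t & forall i : 'I_m, (i < r.+1)%N -> (w y i <= w x i)%N.
  elim: (\max_(y <- s) w y j)%N => [|v [t [tP tdom]]]; first by exists [::].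
  have [u [uP udom]] := IH (ltnW lt_rm) (fun x => P x /\ w x j = v).
  exists (t ++ u); split=> [x|x Px].
    by rewrite mem_cat => /orP[/tP|/uP[]].
  rewrite ltnS leq_eqVlt => /predU1P[wx|/(tdom _ Px)[y ty le_yx]]; last first.
    by exists y; rewrite // mem_cat ty.
  have [//|y uy le_yx] := udom x; exists y; first by rewrite mem_cat uy orbT.
  move=> i; rewrite ltnS leq_eqVlt => /predU1P[ir|/le_yx //].
  have -> : i = j by apply: val_inj.
  by rewrite wx; case: (uP y uy) => _ ->.
exists (s ++ t); split=> [x|x Px].
  by rewrite mem_cat => /orP[/sP|/tP].
have [/(tdom _ Px)[y ty le_yx]|le_max] := ltnP (w x j) (\max_(y <- s) w y j).
  by exists y; rewrite // mem_cat ty orbT.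
have [y sy le_yx] := sdom x Px; exists y; first by rewrite mem_cat sy.
move=> i; rewrite ltnS leq_eqVlt => /predU1P[ir|/le_yx //].
have -> : i = j by apply: val_inj.
by apply: leq_trans le_max; rewrite (big_rem y) //= leq_maxl.
Qed.

(** Dickson's lemma, applied to the leading monomials of the nonzero elements of the ideal, selects
    finitely many divisors; they lie in a common [V F c]. *)
Lemma fall_bound_finite F : exists c, fall_bound F (Fin c).
Proof.
pose le : rel 'X_{1..m} := fun a b => (a <= b)%O.
have le_mo : monomial_order le.
  split.
  - by split=> [a|b a c]; [apply: lexx | apply: le_trans].
  - by split=> [a b|a b]; [apply: le_anti | apply: le_total].
  - by move=> a b c; rewrite /le lemc_add2l.
  - by move=> a; apply: le0m.
have le_deg : degree_refining le by move=> a b /lt_mdeg_ltmc/ltW.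
have lead f a : leading_monomial le f a <-> f != 0 /\ a = mlead f.
  split=> [[fa amax]|[nz_f ->]].
    have nz_f : f != 0 by apply: contraTneq fa => ->; rewrite msupp0.
    split=> //; apply: le_anti; rewrite msupp_le_mlead //=.
    by apply: amax; apply: mlead_supp.
  by split=> [|b]; [apply: mlead_supp | apply: msupp_le_mlead].
have [s [sP sdom]] :=
  dickson (fun f : R => ideal F f /\ f != 0) (@mlead m k).
have [c Vs] := @seq_ideal_V F s (fun b sb => proj1 (sP b sb)).
exists c; apply: (division_fall_bound le_mo le_deg Vs) => f a If.
case/lead => nz_f ->; have [//|b sb le_bf] := sdom f.
by exists b, (mlead b); split=> //; apply/lead; split=> //; case: (sP b sb).
Qed.

End FallDegree.

(** * Degree falls and comparison of generating sets *)

Section Comparison.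
Variables (k : fieldType) (m : nat).
Local Notation R := {mpoly k[m]}.
Implicit Types (F G : {fset R}) (f g h p q : R) (W : R -> Prop).

Lemma last_fall_degree_finite F : exists n, last_fall_degree F = Fin n.
Proof.
have [c /last_fall_degree_min] := fall_bound_finite F.
by case: (last_fall_degree F) => // n _; exists n.
Qed.

Lemma degree_le_nat n f : degree_le n%:Z f <-> (deg f <= n)%N.
Proof.
rewrite /degree_le lez_nat; split=> [[->|//]|]; last by right.
by rewrite deg0.
Qed.

Definition falls F c :=
  ~ (forall f, Vint F c%:Z f /\ degree_le (c%:Z - 1) f <-> Vint F (c%:Z - 1) f).

(* [V_{F,-1}] is empty while [V_{F,0}] contains the zero polynomial. *)
Lemma falls0 F : falls F 0.
Proof. by move=> /(_ 0)[+ _]; apply; split; [apply: V0 | left]. Qed.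

(** The inclusion of [V F c] in the part of [V F c.+1] of degree at most [c] always holds, so only
    the converse can fail. *)
Lemma fallsS F c :
  falls F c.+1 <-> ~ (forall f, V F c.+1 f -> (deg f <= c)%N -> V F c f).
Proof.
rewrite /falls (_ : c.+1%:Z - 1 = c%:Z); last by rewrite intS addrC addKr.
split=> nfall eqV; apply: nfall => f.
  split=> [[Vf /degree_le_nat le_fc]|Vf]; first exact: eqV.
  split; first exact: V_leq Vf.
  by apply/degree_le_nat; apply: V_deg Vf.
by move=> Vf le_fc; apply/eqV; split=> //; apply/degree_le_nat.
Qed.

Lemma falls_le F n c : fall_bound F (Fin n) -> falls F c -> (c <= n)%N.
Proof.
case: c => // c bn /fallsS nV; rewrite leqNgt; apply/negP => lt_nc.
case: nV => f /V_ideal If le_fc; apply: V_leq (bn f If).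
by rewrite geq_max le_fc andbT -ltnS.
Qed.

(** Without a fall at [n.+1] the bound [n.+1] would improve to [n]: the two differ only on elements
    of degree at most [n]. *)
Lemma falls_last F n : last_fall_degree F = Fin n -> falls F n.
Proof.
case: n => [_|n dF]; first exact: falls0.
apply/fallsS => eqV; suff /last_fall_degree_min : fall_bound F (Fin n).
  by rewrite dF /= ltnn.
move=> f If; change (V F (maxn n (deg f)) f).
have := last_fall_degree_bound If; rewrite dF /= => Vf.
have [le_fn|lt_nf] := leqP (deg f) n.
  by apply: eqV => //; rewrite (maxn_idPl (leqW le_fn)) in Vf.
by rewrite (maxn_idPr lt_nf) in Vf.
Qed.

(** Common source of items 4, 7 and 8. Here [c] is the index from which [V G] contains the
    generators of [F] available in each degree: [deg_set F], 0 and [j] respectively. *)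
Lemma fall_bound_sub F G c (e : enat) :
  (forall f, ideal G f -> ideal F f) ->
  (forall g i, (c <= i)%N -> g \in F -> (deg g <= i)%N -> V G i g) ->
  ele (Fin c) e -> fall_bound F e -> fall_bound G e.
Proof.
move=> GF FV; case: e => [e|_ _]; last exact: fall_bound_Infty.
move=> /= le_ce bF f If; have := bF f (GF f If).
apply: (V_sub (leqnn _)) => g Fg; apply: FV => //.
by rewrite leq_max le_ce.
Qed.

Lemma lin_span_ideal F f : lin_span (fun g => g \in F) f -> ideal F f.
Proof. by move/(_ _ (ideal_subspace F)); apply=> g; apply: ideal_in. Qed.

Lemma lin_span_V F f i : (deg_set F <= i)%N ->
  lin_span (fun g => g \in F) f -> V F i f.
Proof.
move=> le_Fi /(_ _ (V_subspace F i)); apply=> g Fg.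
apply: V_gen => //; apply: leq_trans le_Fi.
by rewrite /deg_set (big_rem g) //= leq_maxl.
Qed.

Lemma lin_span_in F g : g \in F -> lin_span (fun g => g \in F) g.
Proof. by move=> Fg W _; apply. Qed.

(** The span of [G] lies in [V G (deg_set G)], whose elements have bounded degree. *)
Lemma deg_set_span F G :
  (forall f, lin_span (fun g => g \in F) f -> lin_span (fun g => g \in G) f) ->
  (deg_set F <= deg_set G)%N.
Proof.
move=> sFG; rewrite {1}/deg_set; apply/bigmax_leqP_seq => g Fg _.
exact: V_deg (lin_span_V (leqnn _) (sFG _ (lin_span_in Fg))).
Qed.

Lemma fall_bound_span F G e :
  (forall f, lin_span (fun g => g \in F) f <-> lin_span (fun g => g \in G) f) ->
  ele (Fin (deg_set F)) e -> fall_bound F e -> fall_bound G e.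
Proof.
move=> eqFG; apply: fall_bound_sub => [|g i le_i Fg _].
  apply: ideal_sub => g Gg; apply: lin_span_ideal; apply/eqFG.
  exact: lin_span_in.
apply: lin_span_V; last by apply/eqFG; apply: lin_span_in.
by apply: leq_trans le_i; apply: deg_set_span => f /eqFG.
Qed.

Lemma ele_emax (a b c : enat) : ele (emax a b) c <-> ele a c /\ ele b c.
Proof.
case: c => [c|]; last by case: a b => [a|] [b|].
case: a b => [a|] [b|] //=; try by split=> // -[].
by rewrite geq_max; split=> [/andP//|[-> ->]].
Qed.

Lemma ele_refl a : ele a a. Proof. by case: a => /=. Qed.

Lemma emax_span_le F G :
  (forall f, lin_span (fun g => g \in F) f <-> lin_span (fun g => g \in G) f) ->
  ele (emax (last_fall_degree G) (Fin (deg_set F)))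
      (emax (last_fall_degree F) (Fin (deg_set F))).
Proof.
move=> eqFG.
have [le_dF le_F] := proj1 (ele_emax _ _ _)
  (ele_refl (emax (last_fall_degree F) (Fin (deg_set F)))).
apply/ele_emax; split=> //; apply: last_fall_degree_min.
apply: (fall_bound_span eqFG) => //.
by apply: fall_bound_le (@last_fall_degree_bound _ _ F).
Qed.

(** The second field makes this usable for base change as well as for affine maps. *)
Lemma eq_last_fall_degree (k' : fieldType) F (G : {fset {mpoly k'[m]}}) :
  (forall e, fall_bound F e <-> fall_bound G e) ->
  last_fall_degree F = last_fall_degree G.
Proof.
move=> eqb; apply: ele_anti; apply: last_fall_degree_min; apply/eqb;
  exact: last_fall_degree_bound.
Qed.

Lemma fall_bound_superset F G e :
  (forall f, ideal F f <-> ideal G f) -> F `<=` G ->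
  fall_bound F e -> fall_bound G e.
Proof.
move=> eqI /fsubsetP sFG; apply: (@fall_bound_sub _ _ 0%N) => [f|g i _ Fg|].
- by move/eqI.
- by apply: V_gen; apply: sFG.
- by case: e.
Qed.

Lemma fall_bound_fset1U F g j e :
  V F j g -> ele (Fin j) e -> fall_bound (g |` F) e -> fall_bound F e.
Proof.
move=> Vg; apply: fall_bound_sub => [|h i le_ji].
  by apply: ideal_sub => h Fh; apply: ideal_in; rewrite in_fset1U Fh orbT.
rewrite in_fset1U => /predU1P[->|Fh] le_hi; last exact: V_gen.
exact: V_leq Vg.
Qed.

End Comparison.

(** * Semilinear ring morphisms that do not raise degrees *)

Section Transfer.
Variables (k k' : fieldType) (m : nat) (iota : {rmorphism k -> k'}).
Local Notation R := {mpoly k[m]}.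
Local Notation R' := {mpoly k'[m]}.
Variables (phi : {rmorphism R -> R'}).
Implicit Types (F : {fset R}) (G : {fset R'}) (f g : R).

Lemma ideal_morph F G f : (forall g, g \in F -> phi g \in G) ->
  ideal F f -> ideal G (phi f).
Proof.
move=> FG /(_ (fun f => ideal G (phi f))); apply=> [|g Fg]; last first.
  by apply: ideal_in; apply: FG.
have [I0 ID IM] := ideal_is_ideal G; split=> [|g h Ig Ih|h g Ig].
- by rewrite rmorph0.
- by rewrite rmorphD; apply: ID.
- by rewrite rmorphM; apply: IM.
Qed.

Hypotheses (phiZ : forall a f, phi (a *: f) = iota a *: phi f).
Hypothesis (deg_phi : forall f, (deg (phi f) <= deg f)%N).

(** The preimage of [V G i] under [phi] is a test space for [V F i], because admissible products
    stay admissible. *)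
Lemma V_morph F G i f : (forall g, g \in F -> phi g \in G) ->
  V F i f -> V G i (phi f).
Proof.
move=> FG /(_ (fun f => V G i (phi f))); apply=> [|g Fg le_i|g h Vg le_i].
- split=> [|a g h Vg Vh]; first by rewrite rmorph0; apply: V0.
  by rewrite rmorphD phiZ; apply: (proj2 (V_subspace G i)).
- by apply: V_gen; [apply: FG | apply: leq_trans le_i].
rewrite rmorphM; apply: V_mul => //.
by rewrite -rmorphM; apply: leq_trans le_i.
Qed.
End Transfer.

(** * Invariance under affine changes of variables *)

Section AffineAction.
Variables (k : fieldType) (m : nat).
Local Notation R := {mpoly k[m]}.
Implicit Types (F G : {fset R}) (f : R) (A : affine k m).

(** Pull [f] back by [psi], apply the bound for [F] there, and return by [phi]; neither map raises
    the degree. *)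
Lemma fall_bound_iso (phi psi : {lrmorphism R -> R}) F G e :
  (forall f, (deg (phi f) <= deg f)%N) ->
  (forall f, (deg (psi f) <= deg f)%N) ->
  cancel psi phi ->
  (forall g, g \in F -> phi g \in G) -> (forall g, g \in G -> psi g \in F) ->
  fall_bound F e -> fall_bound G e.
Proof.
move=> deg_phi deg_psi psiK FG GF; case: e => [e|]; last first.
  by move=> _; apply: fall_bound_Infty.
move=> bF f /(ideal_morph GF)/bF Vf; change (V G (maxn e (deg f)) f).
have phiZ a g : phi (a *: g) = idfun a *: phi g by rewrite linearZ.
rewrite -{2}(psiK f); apply: (V_morph phiZ deg_phi FG); apply: V_leq Vf.
by rewrite geq_max leq_maxl leq_max deg_psi orbT.
Qed.

Lemma mpoly_morph_eq (phi psi : {lrmorphism R -> R}) :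
  (forall i, phi 'X_i = psi 'X_i) -> phi =1 psi.
Proof.
move=> eqX f; rewrite [f]mpolyE !raddf_sum; apply: eq_bigr => a _ /=.
rewrite !linearZ /= mpolyXE_id !rmorph_prod; congr (_ *: _).
by apply: eq_bigr => i _; rewrite !rmorphXn /= eqX.
Qed.

(** Coordinate [j] of the row vector [x *m M + b], as a polynomial in [x]. *)
Definition aff_form (b : 'rV[k]_m) (M : 'M[k]_m) (j : 'I_m) : R :=
  \sum_(i < m) M i j *: 'X_i + (b 0 j)%:MP.

Lemma aff_form1 j : aff_form 0 1%:M j = 'X_j.
Proof.
rewrite /aff_form mxE mpolyC0 addr0 (bigD1 j) //= mxE eqxx scale1r.
rewrite big1 ?addr0 //.
by move=> i /negPf neq_ij; rewrite mxE neq_ij scale0r.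
Qed.

(** Composition of affine maps: [x *m N + c] is substituted into [y *m M + b]. *)
Lemma comp_aff_form b M c N j :
  comp_mpoly [tuple aff_form c N i | i < m] (aff_form b M j)
    = aff_form (c *m M + b) (N *m M) j.
Proof.
rewrite /aff_form raddfD raddf_sum /= comp_mpolyC mxE mpolyCD addrA.
congr (_ + _).
transitivity (\sum_(i < m) (M i j *: \sum_(l < m) N l i *: 'X_l
                            + (M i j * c 0 i)%:MP)).
  apply: eq_bigr => i _; rewrite comp_mpolyZ comp_mpolyXU.
  by rewrite -tnth_nth tnth_mktuple scalerDr -[X in _ + X]mul_mpolyC -mpolyCM.
rewrite big_split /= -raddf_sum; congr (_ + _); last first.
  by rewrite mxE; congr (_ %:MP); apply: eq_bigr => i _; rewrite mulrC.
under eq_bigr do rewrite scaler_sumr.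
rewrite exchange_big; apply: eq_bigr => l _; rewrite mxE scaler_suml.
by apply: eq_bigr => i _; rewrite scalerA mulrC.
Qed.

Lemma deg_prod_le (I : Type) (r : seq I) (E : I -> R) (d : I -> nat) :
  (forall i, (deg (E i) <= d i)%N) ->
  (deg (\prod_(i <- r) E i) <= \sum_(i <- r) d i)%N.
Proof.
move=> le_d; elim/big_rec2: _ => [|i y1 y2 _ le_y].
  by rewrite /deg msize1.
by apply: leq_trans (degM_le _ _) _; apply: leq_add.
Qed.

Lemma deg_aff_form b M j : (deg (aff_form b M j) <= 1)%N.
Proof.
apply: (subspaceD (deg_subspace _ _ _)); last by rewrite /deg msizeC; case: eqP.
apply: (subspace_sum (deg_subspace _ _ _)) => i _.
by apply: (subspaceZ _ (deg_subspace _ _ _)); rewrite degX mdeg1.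
Qed.

Lemma deg_comp_le (t : m.-tuple R) f :
  (forall i, (deg (tnth t i) <= 1)%N) -> (deg (comp_mpoly t f) <= deg f)%N.
Proof.
move=> deg_t; rewrite comp_mpolyEX big_seq_cond.
apply: (subspace_sum (deg_subspace _ _ _)) => a; rewrite andbT => fa.
apply: (subspaceZ _ (deg_subspace _ _ _)); rewrite comp_mpolyX.
apply: leq_trans (mdeg_le_deg fa); rewrite mdegE.
apply: deg_prod_le => i; elim: (a i) => [|n IH].
  by rewrite expr0 /deg msize1.
rewrite exprS; apply: leq_trans (degM_le _ _) _.
by rewrite -[n.+1]add1n leq_add.
Qed.

Lemma deg_aff_act A f : (deg (aff_act A f) <= deg f)%N.
Proof.
by apply: deg_comp_le => i; rewrite tnth_mktuple; apply: deg_aff_form.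
Qed.

(** The hypotheses say that the composite affine map on points is the identity; it then suffices to
    compare on the variables. *)
Lemma aff_actK A B :
  aff_vec B *m aff_mx A + aff_vec A = 0 -> aff_mx B *m aff_mx A = 1%:M ->
  cancel (aff_act A) (aff_act B).
Proof.
move=> vecBA mxBA f.
pose phi : {lrmorphism R -> R} :=
  comp_mpoly [tuple aff_form (aff_vec B) (aff_mx B) j | j < m]
  \o comp_mpoly [tuple aff_form (aff_vec A) (aff_mx A) j | j < m].
rewrite -[RHS]/((idfun : {lrmorphism R -> R}) f) -[LHS]/(phi f).
apply: mpoly_morph_eq => i /=.
rewrite comp_mpolyXU -tnth_nth tnth_mktuple comp_aff_form.
by rewrite vecBA mxBA aff_form1.
Qed.

Lemma aff_invP A :
  exists B, cancel (aff_act A) (aff_act B) /\ cancel (aff_act B) (aff_act A).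
Proof.
have uA := aff_unit A.
have uAV : invmx (aff_mx A) \in unitmx by rewrite unitmx_inv.
(* Inverting [x *m M + b] gives [(x - b) *m invmx M]. *)
exists (Affine (- (aff_vec A *m invmx (aff_mx A))) uAV).
split; apply: aff_actK => /=; rewrite ?mulVmx ?mulmxV ?subrr //.
by rewrite mulNmx -mulmxA mulVmx // mulmx1 addNr.
Qed.

Lemma fall_bound_aff A F e :
  fall_bound [fset aff_act A f | f in F] e <-> fall_bound F e.
Proof.
have [B [AK BK]] := aff_invP A.
have inA g : g \in F -> aff_act A g \in [fset aff_act A f | f in F].
  exact: in_imfset.
have inB g : g \in [fset aff_act A f | f in F] -> aff_act B g \in F.
  by case/imfsetP => f Ff ->; rewrite AK.
pose phi C : {lrmorphism R -> R} :=
  comp_mpoly [tuple aff_form (aff_vec C) (aff_mx C) j | j < m].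
split; [apply: (@fall_bound_iso (phi B) (phi A)) => //
       | apply: (@fall_bound_iso (phi A) (phi B)) => //];
  exact: deg_aff_act.
Qed.

End AffineAction.

(** * Invariance under extension of the base field *)

Section BaseChange.
Variables (k k' : fieldType) (m : nat) (iota : {rmorphism k -> k'}).
Local Notation R := {mpoly k[m]}.
Local Notation R' := {mpoly k'[m]}.
Implicit Types (F : {fset R}) (W : R -> Prop) (f g h : R) (p q : R').
Local Notation "f ^iota" := (map_mpoly iota f) (at level 2, format "f ^iota").
Local Notation "F ^base" := [fset map_mpoly iota f | f in F]
  (at level 2, format "F ^base").

Lemma deg_map_mpoly f : deg f^iota = deg f.
Proof.
rewrite /deg !msizeE (perm_big _ (msupp_map_mpoly _ _)) //.
exact: fmorph_inj.
Qed.

(* The k'-span of the image of [W], i.e. [W (x) k'] when [W] is a subspace. *)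
Definition ext_span W p := exists (I : finType) (c : I -> k') (g : I -> R),
  (forall i, W (g i)) /\ p = \sum_i c i *: (g i)^iota.

Lemma ext_span_subspace W : subspace (ext_span W).
Proof.
split=> [|a _ _ [I [c [g [Wg ->]]]] [J [d [h [Wh ->]]]]].
  exists void, (fun=> 0), (fun=> 0); split; first by case.
  by rewrite big1.
exists (I + J)%type.
exists (fun x => match x with inl i => a * c i | inr j => d j end).
exists (fun x => match x with inl i => g i | inr j => h j end).
split; first by case.
rewrite big_sumType /= scaler_sumr; congr (_ + _).
by apply: eq_bigr => i _; rewrite scalerA.
Qed.

Lemma ext_span_in W f : W f -> ext_span W f^iota.
Proof.
move=> Wf; exists unit, (fun=> 1), (fun=> f); split=> //.
by rewrite (big_pred1 tt) ?scale1r // => -[].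
Qed.

(* A shortest expression: whenever the scalars [c i] with [g i != 0] satisfy a
   relation over [k], it can be used to make one more [g i] vanish. *)
Lemma ext_span_indep W p : subspace W -> ext_span W p ->
  exists (I : finType) (c : I -> k') (g : I -> R),
  [/\ forall i, W (g i), p = \sum_i c i *: (g i)^iota
    & forall a : I -> k, (forall i, g i = 0 -> a i = 0) ->
        \sum_i c i * iota (a i) = 0 -> forall i, a i = 0].
Proof.
move=> sW [I [c [g [Wg ->]]]]; exists I, c.
have [n] := ubnP #|[set i | g i != 0]|; elim: n => // n IH in g Wg *.
rewrite ltnS => le_gn.
have [indep|] := classic (forall a : I -> k, (forall i, g i = 0 -> a i = 0) ->
    \sum_i c i * iota (a i) = 0 -> forall i, a i = 0).
  by exists g.
case/not_all_ex_not => a nind; have [ga nind'] := imply_to_and _ _ nind.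
have [ca0 na0] := imply_to_and _ _ nind'.
have [j /eqP nz_aj] := not_all_ex_not _ _ na0.
(* Subtracting these multiples of [g j] leaves the sum unchanged by the relation on the [c i]. It
   kills [g j], and zero entries stay zero because [a] vanishes there. *)
pose h i := g i - (a i / a j) *: g j.
have [i||h' [Wh' eqh' indep]] := IH h.
- rewrite /h addrC -scaleNr; apply: (proj2 sW); exact: Wg.
- apply: leq_trans le_gn; apply: proper_card; apply/properP; split.
    apply/subsetP => i; rewrite !inE; apply: contraNneq => gi0.
    by rewrite /h gi0 ga // mul0r scale0r subrr.
  exists j; rewrite inE; first by apply: contra nz_aj => /eqP/ga->.
  by rewrite /h divff // scale1r subrr eqxx.
exists h'; split=> //; rewrite -eqh'.
under [RHS]eq_bigr => i _ do
  rewrite rmorphB /= map_mpolyZ scalerBr scalerA fmorph_div mulrA.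
by rewrite sumrB -scaler_suml -mulr_suml ca0 mul0r scale0r subr0.
Qed.

(** Comparing coefficients at [a] and at the leading monomial of [f] gives relations over [k].
    Independence makes every [g i] proportional to [f], and some [g i] has a nonzero coefficient at
    that monomial. *)
Lemma ext_span_descent W f : subspace W -> ext_span W f^iota -> W f.
Proof.
move=> sW /(ext_span_indep sW)[I [c [g [Wg eqf indep]]]].
have [->|] := eqVneq f 0; first by case: sW.
rewrite -mleadc_eq0; set a0 := mlead f => nz_fa.
have eqc a : iota f@_a = \sum_i c i * iota (g i)@_a.
  rewrite -mcoeff_map_mpoly eqf raddf_sum; apply: eq_bigr => i _ /=.
  by rewrite mcoeffZ mcoeff_map_mpoly.
have prop i a : f@_a0 * (g i)@_a = f@_a * (g i)@_a0.
  apply/eqP; rewrite -subr_eq0; apply/eqP; move: i.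
  apply: (indep (fun i => f@_a0 * (g i)@_a - f@_a * (g i)@_a0)) => [i ->|].
    by rewrite !mcoeff0 !mulr0 subrr.
  under eq_bigr do rewrite rmorphB !rmorphM mulrBr !(mulrCA _ (iota f@_ _)).
  by rewrite sumrB -!mulr_sumr -!eqc mulrC subrr.
have [i nz_gi] : exists i, (g i)@_a0 != 0.
  apply: NNPP => no_i; case/eqP: nz_fa; apply: (fmorph_inj iota).
  rewrite eqc rmorph0 big1 // => i _.
  have [->|nz] := eqVneq (g i)@_a0 0; first by rewrite rmorph0 mulr0.
  by case: no_i; exists i.
suff -> : f = (f@_a0 / (g i)@_a0) *: g i by apply: subspaceZ.
by apply/mpolyP => a; rewrite mcoeffZ mulrAC prop mulfK.
Qed.

(** At a monomial of degree above [deg p] the coefficients of the [g i] satisfy a relation over [k],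
    so they all vanish. *)
Lemma ext_span_deg W p : subspace W -> ext_span W p ->
  ext_span (fun f => W f /\ (deg f <= deg p)%N) p.
Proof.
move=> sW /(ext_span_indep sW)[I [c [g [Wg eqp indep]]]].
exists I, c, g; split=> // i; split=> //; apply/deg_leP => a.
apply: contraLR; rewrite -ltnNge => lt_pa; rewrite -mcoeff_eq0; apply/eqP.
move: i; apply: (indep (fun i => (g i)@_a)) => [i ->|].
  by rewrite mcoeff0.
transitivity p@_a.
  rewrite eqp raddf_sum; apply: eq_bigr => i _ /=.
  by rewrite mcoeffZ mcoeff_map_mpoly.
apply/eqP; rewrite mcoeff_eq0; apply: contraTN lt_pa => /mdeg_le_deg.
by rewrite -leqNgt.
Qed.

(** The multiplier [q] has coefficients in [k'], but its monomials are already defined over [k]. *)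
Lemma ext_span_mul W W' p q :
  (forall a g, a \in msupp q -> W g -> W' ('X_[a] * g)) ->
  ext_span W p -> ext_span W' (q * p).
Proof.
move=> WW' [I [c [g [Wg ->]]]]; rewrite [q]mpolyE mulr_suml big_seq_cond.
apply: (subspace_sum (ext_span_subspace W')) => a; rewrite andbT => qa.
rewrite mulr_sumr; apply: (subspace_sum (ext_span_subspace W')) => i _.
rewrite -scalerAl -scalerAr; do 2!apply: (subspaceZ _ (ext_span_subspace W')).
by rewrite -(map_mpolyX iota) -rmorphM; apply: ext_span_in; apply: WW'.
Qed.

Lemma base_ideal F p : ideal F^base p -> ext_span (ideal F) p.
Proof.
move/(_ (ext_span (ideal F))); apply=> [|_ /imfsetP[/= f Ff ->]]; last first.
  by apply: ext_span_in; apply: ideal_in.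
have [E0 _] := ext_span_subspace (ideal F).
split=> // [p1 p2|q p1]; first exact: subspaceD (ext_span_subspace _).
apply: ext_span_mul => a g _ Ig.
by case: (ideal_is_ideal F) => _ _; apply.
Qed.

Lemma base_V F i p : V F^base i p <-> ext_span (V F i) p.
Proof.
have FG g : g \in F -> g^iota \in F^base by apply: in_imfset.
split; last first.
  case=> I [c [g [Vg ->]]]; apply: (subspace_sum (V_subspace _ _)) => j _.
  apply: (subspaceZ _ (V_subspace _ _)).
  apply: (V_morph (map_mpolyZ iota)) FG (Vg j) => f.
  by rewrite deg_map_mpoly.
move/(_ _ (ext_span_subspace _)); apply=> [_ /imfsetP[/= f Ff ->]|q h Vq le_i].
  by rewrite deg_map_mpoly => le_i; apply: ext_span_in; apply: V_gen.
have [E0 _] := ext_span_subspace (V F i).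
(* For nonzero factors the bound on the product bounds the sum of the degrees; a zero factor would
   give no such information. *)
have [->|nz_q] := eqVneq q 0; first by rewrite mulr0.
have [->|nz_h] := eqVneq h 0; first by rewrite mul0r.
rewrite degM // in le_i.
apply: ext_span_mul (ext_span_deg (V_subspace F i) Vq) => a g ha [Vg le_g].
apply: V_mul => //; apply: leq_trans (degM_le _ _) _; rewrite degX.
by apply: leq_trans le_i; rewrite leq_add // mdeg_le_deg.
Qed.

(** From [k'] to [k] by descent. From [k] to [k'], expand [f] into elements of the ideal of [F] of
    degree at most [deg f] and bound each one. *)
Lemma fall_bound_base F e : fall_bound F^base e <-> fall_bound F e.
Proof.
case: e => [e|]; last by split=> _; apply: fall_bound_Infty.
split=> bF f If.
  have If' : ideal F^base f^iota.
    by apply: ideal_morph If => g; apply: in_imfset.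
  apply: ext_span_descent (V_subspace _ _) _; apply/base_V.
  by rewrite -deg_map_mpoly; apply: bF.
have [I [c [g [Ig eqf]]]] := ext_span_deg (ideal_subspace F) (base_ideal If).
apply/base_V; exists I, c, g; split=> // i; have [Igi le_gf] := Ig i.
by apply: V_leq (bF _ Igi); rewrite geq_max leq_maxl leq_max le_gf orbT.
Qed.

End BaseChange.

Theorem proposition2p6 (k : fieldType) (m : nat) (F G : {fset {mpoly k[m]}})
    (A : affine k m) (k' : fieldType) (iota : {rmorphism k -> k'}) :
  (* 1 *)
  (exists n : nat, last_fall_degree F = Fin n)
  /\
  (* 2 *)
  (forall (le : rel 'X_{1..m}) (B : {fset {mpoly k[m]}}),
     monomial_order le -> degree_refining le ->
     groebner_basis le (ideal F) B ->
     exists c : nat,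
       (forall b, b \in B -> V F c b) /\ ele (last_fall_degree F) (Fin c))
  /\
  (* 3 *)
  (let falls (c : nat) :=
     ~ (forall f, Vint F c%:Z f /\ degree_le (c%:Z - 1) f
              <-> Vint F (c%:Z - 1) f) in
   exists n : nat,
     [/\ last_fall_degree F = Fin n, falls n
       & forall c : nat, falls c -> (c <= n)%N])
  /\
  (* 4 *)
  ((forall f, lin_span (fun g => g \in F) f <-> lin_span (fun g => g \in G) f) ->
   emax (last_fall_degree F) (Fin (deg_set F))
     = emax (last_fall_degree G) (Fin (deg_set F)))
  /\
  (* 5 *)
  last_fall_degree F = last_fall_degree [fset aff_act A f | f in F]
  /\
  (* 6 *)
  last_fall_degree [fset map_mpoly iota f | f in F] = last_fall_degree F
  /\
  (* 7 *)
  ((forall f, ideal F f <-> ideal G f) -> F `<=` G ->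
   ele (last_fall_degree G) (last_fall_degree F))
  /\
  (* 8 *)
  (forall (j : enat) (g : {mpoly k[m]}), Vext F j g ->
   ele (last_fall_degree F) (emax j (last_fall_degree (g |` F)))).
Proof.
have dFP := @last_fall_degree_bound k m.
split; first exact: last_fall_degree_finite.
split.
  move=> le B le_mo le_deg gB; have [c VB] := seq_ideal_V (proj1 gB).
  exists c; split=> //; apply: last_fall_degree_min.
  exact: (groebner_fall_bound le_mo le_deg gB).
split.
  have [n dF] := last_fall_degree_finite F; exists n; split=> //.
    exact: falls_last.
  by move=> c; apply: falls_le; rewrite -dF; apply: dFP.
split.
  move=> eqFG.
  (* Item 4 uses the degree of [F] on both sides; equality with that of [G] makes [emax_span_le]
     applicable in both directions. *)
  have eqd : deg_set F = deg_set G.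
    by apply/eqP; rewrite eqn_leq !deg_set_span // => f /eqFG.
  apply: ele_anti; last exact: emax_span_le.
  by rewrite eqd; apply: emax_span_le => f; apply: iff_sym.
split.
  apply: eq_last_fall_degree => e; apply: iff_sym; exact: fall_bound_aff.
split; first by apply: eq_last_fall_degree => e; apply: fall_bound_base.
split=> [eqI sFG|[j|] g Vg].
- by apply: last_fall_degree_min; apply: fall_bound_superset (dFP F).
- have [le_j le_d] := proj1 (ele_emax _ _ _)
    (ele_refl (emax (Fin j) (last_fall_degree (g |` F)))).
  apply: last_fall_degree_min; apply: (fall_bound_fset1U Vg le_j).
  exact: fall_bound_le le_d (dFP _).
- by case: (last_fall_degree F).
Qed.
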